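(* Let $G$ be a group and let $A=\bigoplus_{g\in G}A_g$ be a finite dimensional $G$-graded algebra over a field $k$. Then $A$ is graded Frobenius if and only if the forgetful functor $U:A-gr\to k-gr$ is a Frobenius functor.
   Context: $A-gr$ denotes the category of $G$-graded left $A$-modules (with degree-preserving $A$-linear maps), and $k-gr$ the category of $G$-graded $k$-vector spaces (with degree-preserving linear maps). The functor $U$ forgets the $A$-action but preserves the $G$-grading. A functor $F:\mathcal{A}\to\mathcal{B}$ is called Frobenius if it is both a left and a right adjoint of one and the same functor $\mathcal{B}\to\mathcal{A}$. The dual space $A^*=\mathrm{Hom}_k(A,k)$ is a graded left $A$-module with $(af)(x)=f(xa)$ and grading $(A^* )_g=\{f\in A^* \mid f(A_h)=0 \text{ for any } h\neq g^{-1}\}$. $A$ is called graded Frobenius if $A\simeq A^*$ in $A-gr$. *)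

(* Defs.v *)
From HB Require Import structures.
From mathcomp Require Import all_boot all_algebra all_field.
From mathcomp Require Import boolp.

Set Implicit Arguments.
Unset Strict Implicit.
Unset Printing Implicit Defensive.

Import GRing.Theory.
Local Open Scope ring_scope.

Record category := Category {
  obj :> Type;
  hom : obj -> obj -> Type;
  idhom : forall X, hom X X;
  (* [comp g f] is "g after f" *)
  comp : forall X Y Z, hom Y Z -> hom X Y -> hom X Z;
  comp1h : forall X Y (f : hom X Y), comp (idhom Y) f = f;
  comph1 : forall X Y (f : hom X Y), comp f (idhom X) = f;
  comphA : forall W X Y Z (h : hom Y Z) (g : hom X Y) (f : hom W X),
    comp h (comp g f) = comp (comp h g) f
}.
Arguments idhom {c} _.
Arguments comp {c X Y Z} _ _.

Definition isomorphic (C : category) (X Y : C) : Prop :=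
  exists (f : hom X Y) (g : hom Y X),
    comp g f = idhom X /\ comp f g = idhom Y.

Record functor (C D : category) := Functor {
  fobj :> C -> D;
  fmap : forall X Y, hom X Y -> hom (fobj X) (fobj Y);
  fmap1 : forall X, fmap (idhom X) = idhom (fobj X);
  fmapM : forall X Y Z (g : hom Y Z) (f : hom X Y),
    fmap (comp g f) = comp (fmap g) (fmap f)
}.
Arguments fmap {C D} _ {X Y} _.

(* [left_adjoint F R]: F is a left adjoint of R (equivalently R is a right
   adjoint of F), given by a natural bijection Hom(F X, Y) ~ Hom(X, R Y). *)
Definition left_adjoint (C D : category) (F : functor C D) (R : functor D C)
    : Prop :=
  exists phi : forall (X : C) (Y : D), hom (F X) Y -> hom X (R Y),
    (forall X Y, bijective (phi X Y)) /\
    (forall X X' Y Y' (u : hom X' X) (v : hom Y Y') (f : hom (F X) Y),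
       phi X' Y' (comp v (comp f (fmap F u)))
       = comp (fmap R v) (comp (phi X Y f) u)).

Definition frobenius_functor (C D : category) (F : functor C D) : Prop :=
  exists R : functor D C, left_adjoint F R /\ left_adjoint R F.

Lemma linear_inj (R : pzRingType) (V W : lmodType R) (f g : {linear V -> W}) :
  f =1 g -> f = g.
Proof.
move=> fg; have : f = g :> (V -> W) by apply/funext.
case: f {fg} => f [[f1] [f2]]; case: g => g [[g1] [g2]] /= fg.
case: g / fg g1 g2 => g1 g2.
by rewrite (Prop_irrelevance f1 g1) (Prop_irrelevance f2 g2).
Qed.

(* V is the internal direct sum of the subspaces V_ g. *)
Definition is_grading (G : groupType) (k : fieldType) (V : lmodType k)
    (V_ : G -> {pred V}) : Prop :=
  [/\ forall g, submod_closed (V_ g),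
      forall v, exists (s : seq G) (f : G -> V),
        (forall g, f g \in V_ g) /\ v = \sum_(g <- s) f g
    & forall (s : seq G) (f : G -> V), uniq s -> (forall g, f g \in V_ g) ->
        \sum_(g <- s) f g = 0 -> forall g, g \in s -> f g = 0].

Record grvect (G : groupType) (k : fieldType) := GrVect {
  grvect_sort :> lmodType k;
  grvect_comp : G -> {pred grvect_sort};
  grvect_grading : is_grading grvect_comp
}.

Record grvect_hom (G : groupType) (k : fieldType) (V W : grvect G k) :=
  GrVectHom {
    grvect_fun :> {linear V -> W};
    grvect_homP : forall g v, v \in grvect_comp g ->
      grvect_fun v \in grvect_comp g
  }.

(* That 1 lies in the component of degree 1 follows from these axioms. *)
Record gralg (G : groupType) (k : fieldType) := GrAlg {
  gralg_sort :> falgType k;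
  gralg_comp : G -> {pred gralg_sort};
  gralg_grading : is_grading gralg_comp;
  gralg_mul : forall g h a b, a \in gralg_comp g -> b \in gralg_comp h ->
    a * b \in gralg_comp (g * h)%g
}.

(* The k-vector space underlying an A-module, with c *: m := c%:A *: m. *)
Definition restr (k : fieldType) (A : falgType k) (M : lmodType A) : Type := M.

Section Restr.
Variables (k : fieldType) (A : falgType k) (M : lmodType A).

HB.instance Definition _ := GRing.Zmodule.on (restr M).

Let rscale (c : k) (m : restr M) : restr M := (c%:A : A) *: (m : M).

Fact rscaleA c d m : rscale c (rscale d m) = rscale (c * d) m.
Proof. by rewrite /rscale scalerA mulr_algl scalerA. Qed.

Fact rscale1 : left_id 1 rscale.
Proof. by move=> m; rewrite /rscale !scale1r. Qed.

Fact rscaleDr : right_distributive rscale +%R.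
Proof. by move=> c m n; rewrite /rscale -scalerDr. Qed.

Fact rscaleDl m : {morph rscale^~ m : c d / c + d}.
Proof. by move=> c d; rewrite /rscale scalerDl -[LHS]/(_ *: _) scalerDl. Qed.

HB.instance Definition _ := GRing.Zmodule_isLmodule.Build k (restr M)
  rscaleA rscale1 rscaleDr rscaleDl.

Lemma restr_scaleE c (m : restr M) : c *: m = ((c%:A : A) *: (m : M) : M).
Proof. by []. Qed.
End Restr.

Record grmod (G : groupType) (k : fieldType) (A : gralg G k) := GrMod {
  grmod_sort :> lmodType A;
  grmod_comp : G -> {pred restr grmod_sort};
  grmod_grading : is_grading grmod_comp;
  grmod_mul : forall g h (a : A) (m : grmod_sort),
    a \in gralg_comp g -> m \in grmod_comp h -> a *: m \in grmod_comp (g * h)%g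
}.

Record grmod_hom (G : groupType) (k : fieldType) (A : gralg G k)
    (M N : grmod A) := GrModHom {
  grmod_fun :> {linear M -> N};
  grmod_homP : forall g m, m \in grmod_comp g -> grmod_fun m \in grmod_comp g
}.

Section GrVectCat.
Variables (G : groupType) (k : fieldType).
Implicit Types V W X : grvect G k.

Lemma grvect_hom_inj V W (f g : grvect_hom V W) : f =1 g -> f = g.
Proof.
case: f g => [f f1] [g g1] /= /linear_inj fg.
by case: g / fg g1 => g1; rewrite (Prop_irrelevance f1 g1).
Qed.

Definition grvect_id V : grvect_hom V V :=
  @GrVectHom G k V V idfun (fun _ _ h => h).

Definition grvect_hcomp V W X (g : grvect_hom W X) (f : grvect_hom V W) :
    grvect_hom V X :=
  @GrVectHom G k V X (g \o f) (fun _ _ h => grvect_homP g (grvect_homP f h)).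

Fact grvect_comp1h V W (f : grvect_hom V W) : grvect_hcomp (grvect_id W) f = f.
Proof. exact: grvect_hom_inj. Qed.

Fact grvect_comph1 V W (f : grvect_hom V W) : grvect_hcomp f (grvect_id V) = f.
Proof. exact: grvect_hom_inj. Qed.

Fact grvect_comphA V W X Y (h : grvect_hom X Y) (g : grvect_hom W X)
    (f : grvect_hom V W) :
  grvect_hcomp h (grvect_hcomp g f) = grvect_hcomp (grvect_hcomp h g) f.
Proof. exact: grvect_hom_inj. Qed.

Definition grvect_cat : category :=
  Category grvect_comp1h grvect_comph1 grvect_comphA.
End GrVectCat.

Section GrModCat.
Variables (G : groupType) (k : fieldType) (A : gralg G k).
Implicit Types M N P : grmod A.

Lemma grmod_hom_inj M N (f g : grmod_hom M N) : f =1 g -> f = g.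
Proof.
case: f g => [f f1] [g g1] /= /linear_inj fg.
by case: g / fg g1 => g1; rewrite (Prop_irrelevance f1 g1).
Qed.

Definition grmod_id M : grmod_hom M M :=
  @GrModHom G k A M M idfun (fun _ _ h => h).

Definition grmod_hcomp M N P (g : grmod_hom N P) (f : grmod_hom M N) :
    grmod_hom M P :=
  @GrModHom G k A M P (g \o f) (fun _ _ h => grmod_homP g (grmod_homP f h)).

Fact grmod_comp1h M N (f : grmod_hom M N) : grmod_hcomp (grmod_id N) f = f.
Proof. exact: grmod_hom_inj. Qed.

Fact grmod_comph1 M N (f : grmod_hom M N) : grmod_hcomp f (grmod_id M) = f.
Proof. exact: grmod_hom_inj. Qed.

Fact grmod_comphA M N P Q (h : grmod_hom P Q) (g : grmod_hom N P)
    (f : grmod_hom M N) :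
  grmod_hcomp h (grmod_hcomp g f) = grmod_hcomp (grmod_hcomp h g) f.
Proof. exact: grmod_hom_inj. Qed.

Definition grmod_cat : category :=
  Category grmod_comp1h grmod_comph1 grmod_comphA.

Definition forget_obj M : grvect G k := GrVect (grmod_grading M).

Section ForgetFun.
Variables (M N : grmod A) (f : grmod_hom M N).
Definition forget_fun : restr M -> restr N := f.
Fact forget_fun_linear : linear forget_fun.
Proof. by move=> c m n; rewrite /forget_fun !restr_scaleE linearP. Qed.
HB.instance Definition _ :=
  GRing.isLinear.Build k (restr M) (restr N) *:%R forget_fun forget_fun_linear.
Definition forget_hom : grvect_hom (forget_obj M) (forget_obj N) :=
  @GrVectHom G k (forget_obj M) (forget_obj N) forget_fun (grmod_homP f).
End ForgetFun.

Fact forget1 M : forget_hom (grmod_id M) = grvect_id (forget_obj M).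
Proof. exact: grvect_hom_inj. Qed.

Fact forgetM M N P (g : grmod_hom N P) (f : grmod_hom M N) :
  forget_hom (grmod_hcomp g f) = grvect_hcomp (forget_hom g) (forget_hom f).
Proof. exact: grvect_hom_inj. Qed.

Definition forget : functor grmod_cat (grvect_cat G k) :=
  @Functor grmod_cat (grvect_cat G k) forget_obj forget_hom forget1 forgetM.
End GrModCat.

Section Regular.
Variables (G : groupType) (k : fieldType) (A : gralg G k).

Definition regular_comp (g : G) : {pred restr A^o} :=
  [pred a | (a : A) \in gralg_comp g].

Fact regular_grading : is_grading regular_comp.
Proof.
have [Asub Aspan Aind] := gralg_grading A; split => // g.
have [A0 Alin] := Asub g; split=> // c a b aP bP.
rewrite restr_scaleE inE -[X in X + _]/((c%:A : A) * (a : A)) mulr_algl.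
exact: Alin.
Qed.

Fact regular_mul g h (a : A) (m : A^o) :
  a \in gralg_comp g -> m \in regular_comp h ->
  a *: m \in regular_comp (g * h)%g.
Proof. exact: gralg_mul. Qed.

Definition regular_grmod : grmod A := GrMod regular_grading regular_mul.
End Regular.

(* A^* = Hom_k(A, k), with (a f)(x) = f(x a). *)
Definition dual (k : fieldType) (A : falgType k) : Type := 'Hom(A, k^o).

Section Dual.
Variables (k : fieldType) (A : falgType k).
HB.instance Definition _ := GRing.Zmodule.on (dual A).

Let dscale (a : A) (f : dual A) : dual A :=
  linfun (fun x : A => (f : 'Hom(A, k^o)) (x * a)).

Let dscaleE a f x :
  (dscale a f : 'Hom(A, k^o)) x = (f : 'Hom(A, k^o)) (x * a).
Proof.
have lin : linear (fun x : A => (f : 'Hom(A, k^o)) (x * a)).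
  by move=> c y z; rewrite mulrDl -scalerAl linearP.
pose F := GRing.isLinear.Build k A k^o *:%R _ lin.
pose L : {linear A -> k^o} :=
    HB.pack (fun x : A => (f : 'Hom(A, k^o)) (x * a)) F.
by rewrite /dscale -[X in linfun X]/(L : A -> k^o) lfunE.
Qed.

Fact dscaleA a b f : dscale a (dscale b f) = dscale (a * b) f.
Proof. by apply/lfunP=> x; rewrite !dscaleE mulrA. Qed.

Fact dscale1 : left_id 1 dscale.
Proof. by move=> f; apply/lfunP=> x; rewrite dscaleE mulr1. Qed.

Fact dscaleDr : right_distributive dscale +%R.
Proof.
move=> a f g; apply/lfunP=> x.
by rewrite dscaleE [RHS]add_lfunE !dscaleE [LHS]add_lfunE.
Qed.

Fact dscaleDl f : {morph dscale^~ f : a b / a + b}.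
Proof.
move=> a b; apply/lfunP=> x.
by rewrite dscaleE [RHS]add_lfunE !dscaleE mulrDr linearD.
Qed.

HB.instance Definition _ := GRing.Zmodule_isLmodule.Build A (dual A)
  dscaleA dscale1 dscaleDr dscaleDl.

Lemma dual_scaleE (a : A) (f : dual A) x :
  (a *: f : dual A) x = (f : 'Hom(A, k^o)) (x * a).
Proof. exact: dscaleE. Qed.
End Dual.

Section Projections.
Variables (G : groupType) (k : fieldType) (V : lmodType k).
Variables (V_ : G -> {pred V}) (gradV : is_grading V_).

Let decomp (v : V) (s : seq G) (f : G -> V) :=
  [/\ uniq s, forall g, f g \in V_ g, forall g, g \notin s -> f g = 0
    & v = \sum_(g <- s) f g].

Let mem0 g : 0 \in V_ g. Proof. by have [/(_ g)[]] := gradV. Qed.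

Let memP g c u v : u \in V_ g -> v \in V_ g -> c *: u + v \in V_ g.
Proof. by have [/(_ g)[_ H] _ _] := gradV; apply: H. Qed.

Let memD g u v : u \in V_ g -> v \in V_ g -> u + v \in V_ g.
Proof. by move=> uP vP; rewrite -[u]scale1r memP. Qed.

Let memB g u v : u \in V_ g -> v \in V_ g -> u - v \in V_ g.
Proof. by move=> uP vP; rewrite addrC -scaleN1r memP. Qed.

Let widen (s t : seq G) (f : G -> V) : uniq s -> uniq t -> {subset s <= t} ->
  (forall g, g \notin s -> f g = 0) -> \sum_(g <- s) f g = \sum_(g <- t) f g.
Proof.
move=> us ut st f0; rewrite -[RHS](big_rmcond_in _ (P := mem s)) /=; last first.
  by move=> g _ /f0.
rewrite -[RHS]big_filter; apply: perm_big; apply: uniq_perm => //.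
  exact: filter_uniq.
by move=> g; rewrite mem_filter /=; case: (boolP (g \in s)) => // /st ->.
Qed.

Let decomp_ex v : exists s f, decomp v s f.
Proof.
have [_ /(_ v)[s [f [fP ->]]] _] := gradV.
exists (undup s), (fun g => \sum_(h <- s | h == g) f h); split.
- exact: undup_uniq.
- by move=> g; apply: (big_ind (fun x => x \in V_ g)) => // [u w|h /eqP <-];
    [exact: memD|].
- move=> g; rewrite mem_undup => gs; rewrite big1_seq // => h /andP[/eqP-> hs].
  by rewrite hs in gs.
- rewrite (exchange_big_dep predT) //= big_seq [RHS]big_seq.
  apply: eq_bigr => h hs; rewrite -big_filter.
  have -> : [seq g <- undup s | h == g] = [:: h].
    rewrite (@eq_filter _ _ (pred1 h)) => [|g]; last by rewrite /= eq_sym.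
    by rewrite filter_pred1_uniq ?undup_uniq ?mem_undup.
  by rewrite big_seq1.
Qed.

Let decomp_uniq v s t f1 f2 : decomp v s f1 -> decomp v t f2 -> f1 =1 f2.
Proof.
move=> [us f1P f10 vs] [ut f2P f20 vt] g.
have [_ _ ind] := gradV.
have [gst|] := boolP (g \in undup (s ++ t)); last first.
  by rewrite mem_undup mem_cat negb_or => /andP[/f10-> /f20->].
apply/eqP; rewrite -subr_eq0; apply/eqP.
apply: (ind (undup (s ++ t)) (fun g => f1 g - f2 g)) => //.
- exact: undup_uniq.
- by move=> h; apply: memB.
have -> : \sum_(h <- undup (s ++ t)) (f1 h - f2 h) = v - v.
  rewrite sumrB {1}vs vt; congr (_ - _); symmetry; apply: widen => //;
    by rewrite ?undup_uniq // => h hs; rewrite mem_undup mem_cat hs ?orbT.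
exact: subrr.
Qed.

Lemma grading_proj : exists p : G -> V -> V,
  [/\ forall g, linear (p g),
      forall g v, p g v \in V_ g,
      forall g h v, v \in V_ h -> p g v = if g == h then v else 0
    & forall v, exists s, [/\ uniq s, forall g, g \notin s -> p g v = 0
                            & v = \sum_(g <- s) p g v]].
Proof.
have /choice[p0 p0P] : forall v, exists f, exists s, decomp v s f.
  by move=> v; have [s [f]] := decomp_ex v; exists f, s.
exists (fun g v => p0 v g); split.
- move=> g c u v; have [s [us uV u0 uE]] := p0P u.
  have [t [ut vV v0 vE]] := p0P v; have [r Dr] := p0P (c *: u + v).
  have st h : h \in s -> h \in undup (s ++ t).
    by rewrite mem_undup mem_cat => ->.
  have tt h : h \in t -> h \in undup (s ++ t).
    by rewrite mem_undup mem_cat orbC => ->.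
  apply: (decomp_uniq Dr (t := undup (s ++ t))
    (f2 := fun g => c *: p0 u g + p0 v g)); split=> //.
  + exact: undup_uniq.
  + by move=> h; apply: memP.
  + move=> h; rewrite mem_undup mem_cat negb_or => /andP[/u0-> /v0->].
    by rewrite scaler0 addr0.
  + rewrite big_split /= -scaler_sumr; congr (_ *: _ + _).
      by rewrite {1}uE; apply: widen; rewrite ?undup_uniq.
    by rewrite {1}vE; apply: widen; rewrite ?undup_uniq.
- by move=> g v; have [s []] := p0P v.
- move=> g h v vh; have [s Ds] := p0P v.
  apply: (decomp_uniq Ds (t := [:: h])
    (f2 := fun g => if g == h then v else 0)); split=> //.
  + by move=> g'; case: eqP => [->|].
  + by move=> g'; rewrite inE => /negPf->.
  + by rewrite big_seq1 eqxx.
- by move=> v; have [s [us vV v0 vE]] := p0P v; exists s.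
Qed.
End Projections.

Section DualGraded.
Variables (G : groupType) (k : fieldType) (A : gralg G k).

Definition dual_comp (g : G) : {pred restr (dual A)} :=
  [pred f : dual A | `[< forall h x, h != (g^-1)%g -> x \in gralg_comp h ->
                           (f : 'Hom(A, k^o)) x = 0 >]].

Fact dual_grading : is_grading dual_comp.
Proof.
have [p [plin pV pE pdec]] := grading_proj (gralg_grading A).
have p_sum g (I : Type) (r : seq I) (F : I -> A) :
    p g (\sum_(i <- r) F i) = \sum_(i <- r) p g (F i).
  pose L : {linear A -> A} :=
    HB.pack (p g) (GRing.isLinear.Build k A A *:%R _ (plin g)).
  exact: (linear_sum L).
have pZ g c x : p g (c *: x) = c *: p g x.
  pose L : {linear A -> A} :=
    HB.pack (p g) (GRing.isLinear.Build k A A *:%R _ (plin g)).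
  exact: (linearZ_LR L).
have [s us sE] : exists2 s : seq G, uniq s &
    forall x : A, x = \sum_(g <- s) p g x.
  have /choice[S SP] := pdec.
  exists (undup (flatten [seq S b | b <- vbasis {:A}])).
    exact: undup_uniq.
  move=> x; have [ux x0 {1}->] := SP x.
  set T := undup _.
  have T0 g : g \notin T -> p g x = 0.
    move=> gT; rewrite (coord_vbasis (memvf x)) p_sum big1 // => i _.
    rewrite pZ; have [_ pb0 _] := SP (vbasis {:A})`_i; rewrite pb0 ?scaler0 //.
    apply: contra gT => gS; rewrite mem_undup; apply/flattenP.
    exists (S (vbasis {:A})`_i) => //; apply: map_f.
    by rewrite mem_nth // size_tuple.
  rewrite -(big_rmcond_in _ (P := mem T)) /=; last by move=> g _ /T0.
  rewrite -[RHS](big_rmcond_in _ (P := mem (S x))) /=; last by move=> g _ /x0.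
  rewrite -[LHS]big_filter -[RHS]big_filter; apply: perm_big; apply: uniq_perm.
  - exact: filter_uniq.
  - by rewrite filter_uniq ?undup_uniq.
  - by move=> g; rewrite !mem_filter /= andbC.
split.
- move=> g; split=> [|c u v /asboolP uP /asboolP vP]; apply/asboolP => h x hg xh.
    by rewrite [LHS]lfunE.
  rewrite [LHS]add_lfunE restr_scaleE [X in X + _]dual_scaleE mulr_algr linearZ.
  by rewrite /= (uP h) ?(vP h) // scaler0 addr0.
- move=> f; pose F g := linfun (fun x : A => (f : 'Hom(A, k^o)) (p (g^-1)%g x)).
  have FE g x : F g x = (f : 'Hom(A, k^o)) (p (g^-1)%g x).
    have lin : linear (fun x : A => (f : 'Hom(A, k^o)) (p (g^-1)%g x)).
      by move=> c y z; rewrite plin linearP.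
    pose L : {linear A -> k^o} :=
      HB.pack (fun x : A => (f : 'Hom(A, k^o)) (p (g^-1)%g x))
              (GRing.isLinear.Build k A k^o *:%R _ lin).
    by rewrite /F -[X in linfun X]/(L : A -> k^o) lfunE.
  exists [seq (g^-1)%g | g <- s], (F : G -> restr (dual A)); split.
    move=> g; apply/asboolP => h x hg xh.
    by rewrite FE (pE _ h) // eq_sym (negPf hg) linear0.
  apply/lfunP => x; rewrite [RHS]sum_lfunE big_map {1}(sE x) linear_sum.
  by apply: eq_bigr => g _; rewrite FE invgK.
- move=> t F ut FP F0 g gt; apply/lfunP => x; rewrite [RHS]lfunE.
  have Fp h h' y : h != (h'^-1)%g -> (F h' : 'Hom(A, k^o)) (p h y) = 0.
    by move=> hh; have /asboolP /(_ h) := FP h'; apply.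
  have -> : (F g : 'Hom(A, k^o)) x = (F g : 'Hom(A, k^o)) (p (g^-1)%g x).
    have [r [ur r0 {1}->]] := pdec x; rewrite linear_sum.
    have [gr|/r0 pg0] := boolP ((g^-1)%g \in r).
      by rewrite (bigD1_seq _ gr ur) /= big1 ?addr0 // => h /Fp.
    rewrite pg0 linear0 big1 // => h _.
    by have [->|hg] := eqVneq h (g^-1)%g; [rewrite pg0 linear0 | apply: Fp].
  have : (\sum_(h <- t) F h : 'Hom(A, k^o)) (p (g^-1)%g x) = 0.
    by rewrite F0 lfunE.
  rewrite sum_lfunE (bigD1_seq g) //= big1 ?addr0 // => h hg.
  by apply: Fp; rewrite (inj_eq invg_inj) eq_sym.
Qed.

Fact dual_mul g h (a : A) (f : dual A) :
  a \in gralg_comp g -> f \in dual_comp h -> a *: f \in dual_comp (g * h)%g.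
Proof.
move=> ag /asboolP fh; apply/asboolP => l x lgh xl.
rewrite dual_scaleE (fh (l * g)%g) //; last exact: gralg_mul.
by apply: contra lgh => /eqP lg; rewrite invgM -lg mulgK.
Qed.

Definition dual_grmod : grmod A := GrMod dual_grading dual_mul.

Definition graded_frobenius : Prop :=
  @isomorphic (grmod_cat A) (regular_grmod A) dual_grmod.
End DualGraded.

(* Main.v *)
Require Import Defs.
From HB Require Import structures.
From mathcomp Require Import all_boot all_algebra all_field.
From mathcomp Require Import boolp.

Set Implicit Arguments.
Unset Strict Implicit.
Unset Printing Implicit Defensive.

Import Defs GRing.Theory.
Local Open Scope ring_scope.

(** The proof exhibits one right adjoint of the forgetful functor U that always
    exists, and asks when it is also a left adjoint.

    Coinduction sends a graded vector space V to Hom_k(A, V), with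
    (a f)(x) = f(x a) and f of degree g when f(A_h) lies in V_(h g) for all h.
    It is right adjoint to U for every A ([forget_coinduction_adjoint]): the
    unit sends m to the map x |-> x m, the counit evaluates at 1, which is
    homogeneous of degree 1.

    If A is graded Frobenius, the image of 1 under A ~ A^* is a linear form lam
    supported in degree 1 such that every form on A is lam(- a) for a unique a
    ([frobenius_form]). Apply this to the coordinate forms of a finite
    homogeneous spanning family e'_j of A: they are lam(- e_j) with e_j of degree
    inverse to that of e'_j, so x is the sum of the lam(x e_j) e'_j. By
    nondegeneracy x is then also the sum of the lam(e'_j x) e_j, and together
    these say that the tensor sum_j e_j (x) e'_j is A-central (the Casimir
    element). Hence u |-> sum_j e_j u(e'_j) is an A-linear map from Hom_k(A, M)
    to M, and with v |-> lam(-) v it forms the counit and the unit of an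
    adjunction making coinduction left adjoint to U
    ([coinduction_forget_adjoint]).

    Conversely, let R be both a left and a right adjoint of U, and look at R k,
    with k in degree 1. As R is a left adjoint, R k represents M |-> Hom(k, U M),
    the degree 1 part of M, as does the regular module: R k ~ A
    ([left_adjoint_ground]). As R is a right adjoint it agrees with coinduction,
    whose value at k is A^* ([right_adjoint_unique], [dual_iso_coind]).
    So A ~ R k ~ A^*. *)

(** * Representing objects and adjunctions *)

Lemma isomorphic_sym (C : category) (X Y : C) :
  isomorphic X Y -> isomorphic Y X.
Proof. by move=> [f [g [gf fg]]]; exists g, f. Qed.

Lemma isomorphic_trans (C : category) (Y X Z : C) :
  isomorphic X Y -> isomorphic Y Z -> isomorphic X Z.
Proof.
move=> [f [g [gf fg]]] [f' [g' [gf' fg']]]; exists (comp f' f), (comp g g').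
split; first by rewrite -comphA (comphA g') gf' comp1h.
by rewrite -comphA (comphA f) fg comp1h.
Qed.

(** Yoneda for two representations of one contravariant functor [P] with action
    [act]: the identities transport to mutually inverse arrows. The bijections
    go from [P] so that no inverse of an adjunction bijection has to be chosen
    for each object at once. *)
Lemma representable_iso (C : category) (X Y : C) (P : C -> Type)
    (act : forall W Z, P Z -> hom W Z -> P W)
    (p : forall Z, P Z -> hom Z X) (q : forall Z, P Z -> hom Z Y) :
    (forall Z, bijective (p Z)) -> (forall Z, bijective (q Z)) ->
    (forall W Z (t : P Z) (u : hom W Z), p W (act W Z t u) = comp (p Z t) u) ->
    (forall W Z (t : P Z) (u : hom W Z), q W (act W Z t u) = comp (q Z t) u) ->
  isomorphic X Y.
Proof.
move=> pbij qbij pact qact.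
have [p' pK p'K] := pbij X; have [q' qK q'K] := qbij Y.
exists (q X (p' (idhom X))), (p Y (q' (idhom Y))); split.
  rewrite -pact -[RHS]p'K; congr (p X _).
  by apply: (bij_inj (qbij X)); rewrite qact q'K comp1h.
rewrite -qact -[RHS]q'K; congr (q Y _).
by apply: (bij_inj (pbij Y)); rewrite pact p'K comp1h.
Qed.

(** Same argument for a covariant functor [P], with bijections into [P]. *)
Lemma corepresentable_iso (C : category) (X Y : C) (P : C -> Type)
    (act : forall Z W, hom Z W -> P Z -> P W)
    (p : forall Z, hom X Z -> P Z) (q : forall Z, hom Y Z -> P Z) :
    (forall Z, bijective (p Z)) -> (forall Z, bijective (q Z)) ->
    (forall Z W (u : hom Z W) f, p W (comp u f) = act Z W u (p Z f)) ->
    (forall Z W (u : hom Z W) f, q W (comp u f) = act Z W u (q Z f)) ->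
  isomorphic X Y.
Proof.
move=> pbij qbij pact qact.
have [p' pK p'K] := pbij Y; have [q' qK q'K] := qbij X.
exists (p' (q Y (idhom Y))), (q' (p X (idhom X))); split.
  by apply: (bij_inj (pbij X)); rewrite pact p'K -qact comph1 q'K.
by apply: (bij_inj (qbij Y)); rewrite qact q'K -pact comph1 p'K.
Qed.

(** [R Y] and [R' Y] both represent [Z |-> hom (F Z) Y]. *)
Lemma right_adjoint_unique (C D : category) (F : functor C D)
    (R R' : functor D C) (Y : D) :
  left_adjoint F R -> left_adjoint F R' -> isomorphic (R Y) (R' Y).
Proof.
move=> [p [pbij pnat]] [q [qbij qnat]].
apply: (@representable_iso C _ _ (fun Z => hom (F Z) Y)
  (fun W Z t u => comp t (fmap F u)) (fun Z => p Z Y) (fun Z => q Z Y)) => //.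
  by move=> W Z t u; rewrite -[X in p _ _ X]comp1h pnat fmap1 comp1h.
by move=> W Z t u; rewrite -[X in q _ _ X]comp1h qnat fmap1 comp1h.
Qed.

Lemma unit_counit_adjoint (C D : category) (F : functor C D) (R : functor D C)
    (eta : forall X : C, hom X (R (F X))) (eps : forall Y : D, hom (F (R Y)) Y) :
    (forall X' X (u : hom X' X),
       comp (eta X) u = comp (fmap R (fmap F u)) (eta X')) ->
    (forall Y Y' (v : hom Y Y'),
       comp v (eps Y) = comp (eps Y') (fmap F (fmap R v))) ->
    (forall X, comp (eps (F X)) (fmap F (eta X)) = idhom (F X)) ->
    (forall Y, comp (fmap R (eps Y)) (eta (R Y)) = idhom (R Y)) ->
  left_adjoint F R.
Proof.
move=> etaN epsN FetaK RepsK.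
exists (fun X Y f => comp (fmap R f) (eta X)); split=> [X Y|X X' Y Y' u v f].
  exists (fun g => comp (eps Y) (fmap F g)) => [f|g].
    by rewrite fmapM comphA -epsN -comphA FetaK comph1.
  by rewrite fmapM -comphA -etaN comphA RepsK comp1h.
by rewrite !fmapM -!comphA -etaN.
Qed.

(** * Gradings *)

Section Gradings.
Variables (G : groupType) (k : fieldType) (V : lmodType k).
Variable V_ : G -> {pred V}.

(** A grading writes a vector as a sum indexed by distinct degrees; a sum with
    several terms of one degree is brought to that form by adding those up. *)
Lemma homogeneous_sum (J : eqType) (r : seq J) (d : J -> G) (F : J -> V) :
    (forall g, submod_closed (V_ g)) -> (forall j, F j \in V_ (d j)) ->
  exists (s : seq G) (f : G -> V),
    (forall g, f g \in V_ g) /\ \sum_(j <- r) F j = \sum_(g <- s) f g.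
Proof.
move=> Vsub FV; exists (undup (map d r)), (fun g => \sum_(j <- r | d j == g) F j).
split=> [g|].
  have [V0 VP] := Vsub g.
  apply: (big_ind (fun x => x \in V_ g)) => // [u v uV vV|j /eqP <- //].
  by rewrite -[u]scale1r VP.
rewrite (exchange_big_dep predT) //=.
rewrite big_seq [RHS]big_seq; apply: eq_bigr => j jr.
rewrite -big_filter (@eq_filter _ _ (pred1 (d j))) => [|g]; last exact: eq_sym.
by rewrite filter_pred1_uniq ?undup_uniq ?mem_undup ?map_f // big_seq1.
Qed.

Lemma linear_grading_proj (gradV : is_grading V_) :
  exists p : G -> {linear V -> V},
    [/\ forall g v, p g v \in V_ g,
        forall g h v, v \in V_ h -> p g v = if g == h then v else 0
      & forall v, exists s, [/\ uniq s, forall g, g \notin s -> p g v = 0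
                              & v = \sum_(g <- s) p g v]].
Proof.
have [p [plin pV pE pdec]] := grading_proj gradV.
pose pL g : {linear V -> V} :=
  HB.pack (p g) (GRing.isLinear.Build k V V *:%R _ (plin g)).
by exists pL.
Qed.
End Gradings.

Section GradedAlgebra.
Variables (G : groupType) (k : fieldType) (A : gralg G k).

(** Finite dimensionality enters here. Splitting a basis of A into homogeneous
    parts gives a spanning family which need not be free, so the [c j] are not
    determined by the [e j]; those taken here, a coordinate after a projection
    onto one degree, are homogeneous elements of A^*. *)
Lemma homogeneous_coordinates :
  exists (J : eqType) (r : seq J) (d : J -> G) (e : J -> A) (c : J -> dual A),
    [/\ forall j, e j \in gralg_comp (d j),
        forall j, c j \in @dual_comp _ _ A (d j)^-1%g
      & forall x, x = \sum_(j <- r) (c j : 'Hom(A, k^o)) x *: e j].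
Proof.
have [p [pA pE pdec]] := linear_grading_proj (gralg_grading A).
pose b := vbasis {:A}.
have /choice[S SP] := pdec.
(* The finitely many degrees that occur in the basis, hence in all of A. *)
pose s := undup (flatten [seq S x | x <- b]).
have bE i : b`_i = \sum_(g <- s) p g b`_i.
  have [ib|bi] := ltnP i (size b); last first.
    by rewrite nth_default // big1 // => g _; rewrite linear0.
  have [us s0 {1}->] := SP b`_i.
  rewrite -[RHS](big_rmcond_in _ (P := mem (S b`_i))) /=; last first.
    by move=> g _ /s0.
  rewrite -[RHS]big_filter; apply: perm_big; apply: uniq_perm => //.
    by rewrite filter_uniq ?undup_uniq.
  move=> g; rewrite mem_filter /= mem_undup.
  case: (boolP (g \in S _)) => //= gS; symmetry; apply/flattenP.
  by exists (S b`_i) => //; apply/map_f/mem_nth.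
pose c (j : 'I_(\dim {:A}) * G) : dual A :=
  linfun (coord b j.1 \o p j.2 : A -> k^o).
have cE j x : (c j : 'Hom(A, k^o)) x = coord b j.1 (p j.2 x) by rewrite /c lfunE.
exists _, [seq (i, g) | i <- enum 'I_(\dim {:A}), g <- s], snd,
  (fun j : 'I_(\dim {:A}) * G => p j.2 b`_j.1), c.
split=> [j|j|x]; first exact: pA.
  apply/asboolP=> h x hj xh; rewrite cE (pE _ h) // ifN ?linear0 //.
  by rewrite eq_sym -(invgK j.2).
rewrite big_allpairs_dep exchange_big /=.
have xE : x = \sum_(g <- s) p g x.
  rewrite {1}(coord_vbasis (memvf x)).
  under eq_bigr do rewrite bE scaler_sumr.
  rewrite exchange_big; apply: eq_bigr => g _ /=.
  rewrite [in RHS](coord_vbasis (memvf x)) [RHS](linear_sum (p g)).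
  by apply: eq_bigr => i _; rewrite [RHS](linearZ_LR (p g)).
rewrite {1}xE; apply: eq_bigr => g _; rewrite big_enum /=.
rewrite -{1}[p g x](_ : p g (p g x) = _); last by rewrite (pE _ g) ?eqxx.
rewrite {1}(coord_vbasis (memvf (p g x))) [LHS](linear_sum (p g)).
by apply: eq_bigr => i _; rewrite cE [LHS](linearZ_LR (p g)).
Qed.

(** The degree 1 part of 1 acts as a left unit on every homogeneous element, by
    comparing components of degree h in x = 1 x for x in A_h; hence it is 1. *)
Lemma one_homogeneous : 1 \in @gralg_comp _ _ A 1%g.
Proof.
have [p [pA pE pdec]] := linear_grading_proj (gralg_grading A).
have homE h x : x \in gralg_comp h -> p 1%g 1 * x = x.
  move=> xh; have [s [us s0 E1]] := pdec 1.
  have {2}-> : x = p h (1 * x) by rewrite mul1r (pE _ h) ?eqxx.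
  rewrite {2}E1 mulr_suml [RHS](linear_sum (p h)) /=.
  rewrite (eq_bigr (fun g => if g == 1%g then p g 1 * x else 0)); last first.
    move=> g _; rewrite (pE _ (g * h)%g) ?gralg_mul //.
    by rewrite -{1}[h]mul1g (inj_eq (mulIg h)) eq_sym.
  rewrite -big_mkcond /=; case: (boolP (1%g \in s)) => [s1|/[dup] s1 /s0 ->].
    rewrite -big_filter (@eq_filter _ _ (pred1 1%g)) //.
    by rewrite filter_pred1_uniq // big_seq1.
  rewrite mul0r big1_seq // => g /andP[/eqP -> gs].
  by rewrite gs in s1.
suff one1 : p 1%g 1 * 1 = 1 by rewrite -one1 mulr1.
have [s [us s0 E1]] := pdec 1.
rewrite [X in _ * X]E1 mulr_sumr [RHS]E1.
by apply: eq_bigr => g _; rewrite (homE g).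
Qed.
End GradedAlgebra.

(** * The coinduced module Hom_k(A, V) *)

Record coind (k : fieldType) (A : falgType k) (V : lmodType k) :=
  Coind { coind_fun :> {linear A -> V} }.

Section CoindModule.
Variables (k : fieldType) (A : falgType k) (V : lmodType k).
Implicit Types f g h : coind A V.

HB.instance Definition _ := gen_eqMixin (coind A V).
HB.instance Definition _ := gen_choiceMixin (coind A V).

Lemma coindP f g : f =1 g -> f = g.
Proof. by case: f g => [f] [g] /= /linear_inj ->. Qed.

Let zero : coind A V := Coind \0.
Let opp f : coind A V := Coind (\- f).
Let add f g : coind A V := Coind (f \+ g).

Fact coind_addA : associative add.
Proof. by move=> f g h; apply: coindP => x /=; rewrite addrA. Qed.

Fact coind_addC : commutative add.
Proof. by move=> f g; apply: coindP => x /=; rewrite addrC. Qed.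

Fact coind_add0 : left_id zero add.
Proof. by move=> f; apply: coindP => x /=; rewrite add0r. Qed.

Fact coind_addN : left_inverse zero opp add.
Proof. by move=> f; apply: coindP => x /=; rewrite addNr. Qed.

HB.instance Definition _ := GRing.isZmodule.Build (coind A V)
  coind_addA coind_addC coind_add0 coind_addN.

Section Scale.
Variables (a : A) (f : coind A V).
Definition coind_scale_fun (x : A) : V := f (x * a).
Fact coind_scale_linear : linear coind_scale_fun.
Proof.
by move=> c x y; rewrite /coind_scale_fun mulrDl -scalerAl linearP.
Qed.
HB.instance Definition _ :=
  GRing.isLinear.Build k A V *:%R coind_scale_fun coind_scale_linear.
Definition coind_scale : coind A V := Coind coind_scale_fun.
End Scale.

Fact coind_scaleA a b f :
  coind_scale a (coind_scale b f) = coind_scale (a * b) f.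
Proof. by apply: coindP => x; rewrite /= /coind_scale_fun /= mulrA. Qed.

Fact coind_scale1 : left_id 1 coind_scale.
Proof. by move=> f; apply: coindP => x /=; rewrite /coind_scale_fun mulr1. Qed.

Fact coind_scaleDr : right_distributive coind_scale +%R.
Proof. by move=> a f g; apply: coindP. Qed.

Fact coind_scaleDl f : {morph coind_scale^~ f : a b / a + b}.
Proof.
by move=> a b; apply: coindP => x /=; rewrite /coind_scale_fun mulrDr linearD.
Qed.

HB.instance Definition _ := GRing.Zmodule_isLmodule.Build A (coind A V)
  coind_scaleA coind_scale1 coind_scaleDr coind_scaleDl.

Lemma coind0E x : (0 : coind A V) x = 0. Proof. by []. Qed.

Lemma coindDE f g x : (f + g) x = f x + g x. Proof. by []. Qed.

Lemma coindZE (a : A) f x : (a *: f) x = f (x * a). Proof. by []. Qed.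

(** The k-structure induced by A on Hom_k(A, V) is the pointwise one. *)
Lemma coind_restrZE (c : k) (f : restr (coind A V)) x :
  (c *: f : coind A V) x = c *: (f : coind A V) x.
Proof. by rewrite restr_scaleE coindZE mulr_algr linearZ. Qed.

Lemma coind_sumE (I : Type) (r : seq I) (F : I -> coind A V) x :
  (\sum_(i <- r) F i) x = \sum_(i <- r) F i x.
Proof. by elim/big_rec2: _ => // i y f _ <-. Qed.
End CoindModule.

(** The image of f (x) v under A^* (x) V -> Hom_k(A, V). These maps give the
    homogeneous decompositions in Hom_k(A, V), and the unit of the second
    adjunction. *)
Section RankOne.
Variables (k : fieldType) (A : falgType k) (V : lmodType k).
Variables (f : dual A) (v : V).
Definition rank_one_fun (x : A) : V := (f : 'Hom(A, k^o)) x *: v.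
Fact rank_one_linear : linear rank_one_fun.
Proof.
by move=> c x y; rewrite /rank_one_fun linearP scalerDl scalerA.
Qed.
HB.instance Definition _ :=
  GRing.isLinear.Build k A V *:%R rank_one_fun rank_one_linear.
Definition rank_one : coind A V := Coind rank_one_fun.
End RankOne.

Section CoindGraded.
Variables (G : groupType) (k : fieldType) (A : gralg G k) (V : grvect G k).

Definition coind_comp (g : G) : {pred restr (coind A V)} :=
  [pred f : coind A V | `[< forall h x, x \in gralg_comp h ->
                              f x \in grvect_comp (h * g)%g >]].

(** On A_l with l = g^-1 the value lies in V_h, and l (g h) = h; [f] vanishes on
    the other components. *)
Lemma rank_one_homogeneous g h (f : dual A) (v : V) :
  f \in dual_comp g -> v \in grvect_comp h -> rank_one f v \in coind_comp (g * h)%g.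
Proof.
move=> /asboolP fg vh; apply/asboolP => l x xl /=; rewrite /rank_one_fun.
have [lg|lg] := eqVneq l g^-1%g; last first.
  by rewrite (fg l) // scale0r; have [/(_ (l * (g * h))%g) []] := grvect_grading V.
have [/(_ h) [V0 VP] _ _] := grvect_grading V.
rewrite lg mulKg -[_ *: _]addr0; exact: VP.
Qed.

(** In homogeneous coordinates f is the sum of the rank one maps
    c_j (x) f(e_j); decomposing the finitely many f(e_j) in V yields homogeneous
    rank one maps. Independence is inherited from V at each homogeneous x. *)
Fact coind_grading : is_grading coind_comp.
Proof.
have [Vsub Vspan Vind] := grvect_grading V.
have sub g : submod_closed (coind_comp g).
  split=> [|c f f' /asboolP fg /asboolP f'g]; apply/asboolP => h x xh.
    by rewrite coind0E; have [] := Vsub (h * g)%g.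
  rewrite coindDE coind_restrZE; have [_ VP] := Vsub (h * g)%g.
  by apply: VP; [exact: fg | exact: f'g].
split=> // [f|s f us fP f0 g gs].
  have [J [r [d [e [c [eA cA cE]]]]]] := homogeneous_coordinates A.
  have /choice[S /choice[w SwP]] := fun j => Vspan ((f : coind A V) (e j)).
  have wP j g : w j g \in grvect_comp g by have [] := SwP j.
  pose F (t : J * G) : restr (coind A V) := rank_one (c t.1) (w t.1 t.2).
  have -> : f = \sum_(t <- [seq (j, g) | j <- r, g <- S j]) F t.
    apply: (@coindP _ A V) => x; rewrite [RHS]coind_sumE big_allpairs_dep.
    rewrite {1}[x]cE linear_sum; apply: eq_bigr => j _ /=.
    rewrite linearZ /= {1}(SwP j).2 scaler_sumr.
    exact: eq_bigr.
  apply: (@homogeneous_sum _ _ _ _ _ _ (fun t => (d t.1)^-1 * t.2)%g) => // t.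
  exact: rank_one_homogeneous.
apply: (@coindP _ A V) => x; rewrite coind0E.
have [_ /(_ x) [t [y [yA ->]]] _] := gralg_grading A.
rewrite linear_sum big1 // => h _.
(* At x of degree h the term [f l] has degree h l: reindex by l |-> h l. *)
pose v l := (f (h^-1 * l)%g : coind A V) (y h).
rewrite -[LHS]/((f g : coind A V) (y h)) -[g](mulKg h) -/(v (h * g)%g).
apply: (Vind [seq (h * g')%g | g' <- s]); last exact: map_f.
- by rewrite map_inj_uniq //; apply: mulgI.
- by move=> l; have /asboolP/(_ h (y h) (yA h)) := fP (h^-1 * l)%g; rewrite mulVKg.
rewrite big_map; transitivity ((\sum_(g <- s) f g : coind A V) (y h)).
  rewrite coind_sumE.
  by apply: eq_bigr => l _; rewrite /v mulKg.
by rewrite f0.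
Qed.

Fact coind_mul g h (a : A) (f : coind A V) :
  a \in gralg_comp g -> f \in coind_comp h -> a *: f \in coind_comp (g * h)%g.
Proof.
move=> ag /asboolP fh; apply/asboolP => l x xl.
by rewrite coindZE mulgA; apply: fh; apply: gralg_mul.
Qed.

Definition coind_grmod : grmod A := GrMod coind_grading coind_mul.
End CoindGraded.

Section CoindFunctor.
Variables (G : groupType) (k : fieldType) (A : gralg G k).

Section CoindMap.
Variables (V W : grvect G k) (u : grvect_hom V W).
Definition coind_map (f : coind A V) : coind A W := Coind (u \o f).
Fact coind_map_linear : linear coind_map.
Proof. by move=> a f g; apply: coindP => x /=; rewrite linearD. Qed.
HB.instance Definition _ :=
  GRing.isLinear.Build A (coind A V) (coind A W) *:%R coind_map coind_map_linear.
Fact coind_map_homogeneous g (f : coind A V) :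
  f \in @coind_comp _ _ A V g -> coind_map f \in @coind_comp _ _ A W g.
Proof.
move=> /asboolP fg; apply/asboolP => h x xh.
by apply: grvect_homP; apply: fg.
Qed.
Definition coind_hom : grmod_hom (coind_grmod A V) (coind_grmod A W) :=
  @GrModHom G k A (coind_grmod A V) (coind_grmod A W) coind_map
    coind_map_homogeneous.
End CoindMap.

Fact coind_hom1 V : coind_hom (grvect_id V) = grmod_id (coind_grmod A V).
Proof. by apply: grmod_hom_inj => f; apply: coindP. Qed.

Fact coind_homM V W X (v : grvect_hom W X) (u : grvect_hom V W) :
  coind_hom (grvect_hcomp v u) = grmod_hcomp (coind_hom v) (coind_hom u).
Proof. by apply: grmod_hom_inj => f; apply: coindP. Qed.

Definition coinduction : functor (grvect_cat G k) (grmod_cat A) :=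
  @Functor (grvect_cat G k) (grmod_cat A) (coind_grmod A) coind_hom
    coind_hom1 coind_homM.

Section Orbit.
Variable M : grmod A.
Section OrbitMap.
Variable m : M.
Definition orbit_fun (x : A) : restr M := x *: m.
Fact orbit_fun_linear : linear orbit_fun.
Proof.
move=> c x y; rewrite /orbit_fun restr_scaleE scalerA mulr_algl.
exact: (@scalerDl A M m (c *: x) y).
Qed.
HB.instance Definition _ :=
  GRing.isLinear.Build k A (restr M) *:%R orbit_fun orbit_fun_linear.
Definition orbit_map : coind A (restr M) := Coind orbit_fun.
End OrbitMap.
Fact orbit_map_linear : linear orbit_map.
Proof.
move=> a m n; apply: coindP => x.
by rewrite coindDE coindZE /= /orbit_fun scalerDr scalerA.
Qed.
HB.instance Definition _ :=
  GRing.isLinear.Build A M (coind A (restr M)) *:%R orbit_map orbit_map_linear.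
Fact orbit_map_homogeneous g (m : M) :
  m \in grmod_comp g -> orbit_map m \in @coind_comp _ _ A (forget_obj M) g.
Proof.
by move=> mg; apply/asboolP => h x xh; apply: grmod_mul.
Qed.
Definition orbit_hom : grmod_hom M (coind_grmod A (forget_obj M)) :=
  @GrModHom G k A M (coind_grmod A (forget_obj M)) orbit_map
    orbit_map_homogeneous.
End Orbit.

Section Eval.
Variable V : grvect G k.
Definition eval1 (f : restr (coind A V)) : V := (f : coind A V) 1.
Fact eval1_linear : linear eval1.
Proof. by move=> c f g; rewrite /eval1 coindDE coind_restrZE. Qed.
HB.instance Definition _ :=
  GRing.isLinear.Build k (restr (coind A V)) V *:%R eval1 eval1_linear.
Fact eval1_homogeneous g (f : restr (coind A V)) :
  f \in @coind_comp _ _ A V g -> eval1 f \in grvect_comp g.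
Proof.
by move=> /asboolP/(_ _ _ (one_homogeneous A)); rewrite mul1g.
Qed.
Definition eval1_hom : grvect_hom (forget_obj (coind_grmod A V)) V :=
  @GrVectHom G k (forget_obj (coind_grmod A V)) V eval1 eval1_homogeneous.
End Eval.

(** Both triangle identities reduce to 1 m = m and 1 x = x. *)
Lemma forget_coinduction_adjoint : left_adjoint (forget A) coinduction.
Proof.
apply: (@unit_counit_adjoint (grmod_cat A) (grvect_cat G k) (forget A)
  coinduction orbit_hom eval1_hom).
- move=> M N u; apply: grmod_hom_inj => m; apply: coindP => x /=.
  by rewrite /orbit_fun /forget_fun linearZ.
- by move=> V W u; apply: grvect_hom_inj => f.
- by move=> M; apply: grvect_hom_inj => m; apply: (@scale1r A M m).
- move=> V; apply: grmod_hom_inj => f; apply: coindP => x /=.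
  by rewrite /eval1 /= /coind_scale_fun mul1r.
Qed.
End CoindFunctor.

(** * The regular and dual modules as values of adjoints *)

Section GroundField.
Variables (G : groupType) (k : fieldType).

Definition ground_comp (g : G) : {pred k^o} :=
  [pred c | (g == 1%g) || (c == 0)].

Fact ground_grading : is_grading ground_comp.
Proof.
split=> [g|c|s f us fP f0 g gs].
- split=> [|a c d]; rewrite !inE ?eqxx ?orbT //.
  by case: (g == 1%g) => //= /eqP-> /eqP->; rewrite scaler0 addr0.
- exists [:: 1%g], (fun g => if g == 1%g then c else 0).
  split=> [g|]; last by rewrite big_seq1 eqxx.
  by rewrite inE; case: (g == 1%g) => //=.
have off1 h : h != 1%g -> f h = 0.
  by move=> h1; have := fP h; rewrite inE (negPf h1) => /eqP.
have [g1|/off1//] := eqVneq g 1%g.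
rewrite -[RHS]f0 (bigD1_seq g) //= big1 ?addr0 // => h.
by rewrite g1 => /off1.
Qed.

Definition ground : grvect G k := GrVect ground_grading.
End GroundField.

Section Representing.
Variables (G : groupType) (k : fieldType) (A : gralg G k).
Let k1 : grvect G k := ground G k.

Fact dual_to_coind_linear :
  linear (fun f : dual A => Coind (f : 'Hom(A, k^o))).
Proof.
by move=> a f g; apply: coindP => x; rewrite /= add_lfunE [X in X + _]dual_scaleE.
Qed.
Definition dual_to_coind : {linear dual A -> coind A k^o} :=
  HB.pack (fun f : dual A => Coind (f : 'Hom(A, k^o)))
    (GRing.isLinear.Build _ _ _ _ _ dual_to_coind_linear).

Fact coind_to_dual_linear :
  linear (fun f : coind A k^o => linfun f : dual A).
Proof.
move=> a f g; apply/lfunP => x.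
by rewrite add_lfunE [X in _ = X + _]dual_scaleE !lfunE.
Qed.
Definition coind_to_dual : {linear coind A k^o -> dual A} :=
  HB.pack (fun f : coind A k^o => linfun f : dual A)
    (GRing.isLinear.Build _ _ _ _ _ coind_to_dual_linear).

(** The degrees match: f(A_h) lies in the part of k of degree h g exactly when
    h = g^-1 or f vanishes on A_h. *)
Lemma dual_iso_coind :
  @isomorphic (grmod_cat A) (dual_grmod A) (coind_grmod A k1).
Proof.
have to_hom g (f : dual A) : f \in @dual_comp _ _ A g ->
    dual_to_coind f \in @coind_comp _ _ A k1 g.
  move=> /asboolP fg; apply/asboolP=> h x xh; rewrite inE.
  have [//|/= hg1] := eqVneq (h * g)%g 1%g; apply/eqP/(fg h) => //.
  by apply: contra hg1 => /eqP ->; rewrite mulVg.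
have of_hom g (f : coind A k^o) : f \in @coind_comp _ _ A k1 g ->
    coind_to_dual f \in @dual_comp _ _ A g.
  move=> /asboolP fg; apply/asboolP=> h x hg xh; rewrite lfunE.
  have := fg h x xh; rewrite inE => /orP[|/eqP//].
  by rewrite -(inj_eq (mulIg g^-1%g)) mulgK mul1g (negPf hg).
exists (@GrModHom G k A (dual_grmod A) (coind_grmod A k1) dual_to_coind to_hom),
  (@GrModHom G k A (coind_grmod A k1) (dual_grmod A) coind_to_dual of_hom).
split; apply: grmod_hom_inj => f.
  by apply/lfunP => x; rewrite lfunE.
by apply: coindP => x; rewrite /= lfunE.
Qed.

Fact ground_unit_linear :
  linear (fun c : k^o => ((c : k)%:A : A) : restr A^o).
Proof.
move=> c x y; rewrite restr_scaleE scalerDl; congr (_ + _).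
by rewrite -[LHS]/((c * x) *: 1) -scalerA -[RHS]/(c%:A * x%:A) mulr_algl.
Qed.
Definition ground_unit_fun : {linear k1 -> restr A^o} :=
  HB.pack (fun c : k^o => ((c : k)%:A : A) : restr A^o)
    (GRing.isLinear.Build _ _ _ _ _ ground_unit_linear).
Fact ground_unit_homogeneous g (c : k1) :
  c \in grvect_comp g -> ground_unit_fun c \in @regular_comp _ _ A g.
Proof.
have [/(_ 1%g) [A0 AP] _ _] := gralg_grading A.
rewrite !inE => /orP[/eqP ->|/eqP ->]; last first.
  by rewrite linear0; have [/(_ g) []] := gralg_grading A.
rewrite -[X in X \in _]/(c%:A : A) -[_%:A]addr0; apply: AP => //.
exact: one_homogeneous.
Qed.
(** The universal arrow from k to U: A is the free graded module on one
    generator of degree 1. *)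
Definition ground_unit : grvect_hom k1 (forget_obj (regular_grmod A)) :=
  @GrVectHom G k k1 (forget_obj (regular_grmod A)) ground_unit_fun
    ground_unit_homogeneous.

(** A homogeneous map k -> U M is an element of M_1, which is the image of 1 under
    exactly one graded morphism A -> M. *)
Lemma regular_universal (M : grmod A) :
  bijective (fun f : @hom (grmod_cat A) (regular_grmod A) M =>
    comp (fmap (forget A) f) ground_unit).
Proof.
pose act (m : M) (a : A^o) : M := a *: m.
have act_linear m : linear (act m).
  by move=> a x y; rewrite /act scalerDl scalerA.
pose actL m : {linear A^o -> M} :=
  HB.pack (act m) (GRing.isLinear.Build _ _ _ _ _ (act_linear m)).
have actP (t : grvect_hom k1 (forget_obj M)) g (a : A^o) :
    a \in @regular_comp _ _ A g -> actL (t 1) a \in grmod_comp g.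
  move=> ag; rewrite -[g]mulg1; apply: grmod_mul => //.
  by apply: (grvect_homP t); rewrite inE eqxx.
exists (fun t : grvect_hom k1 (forget_obj M) =>
  @GrModHom G k A (regular_grmod A) M (actL (t 1)) (actP t)) => [f|t].
  apply: grmod_hom_inj => a /=; rewrite /act /forget_fun /= scale1r.
  by rewrite -linearZ /= -[X in f X]/(a * 1) mulr1.
apply: grvect_hom_inj => c /=.
have -> : t c = (c : k) *: (t 1 : forget_obj M).
  by rewrite -linearZ; congr (t _); rewrite -[RHS]/(c * 1) mulr1.
by rewrite [RHS]restr_scaleE.
Qed.

(** By the adjunction and by [regular_universal], both modules corepresent
    [M |-> hom k (U M)]. *)
Lemma left_adjoint_ground (L : functor (grvect_cat G k) (grmod_cat A)) :
  left_adjoint L (forget A) ->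
  @isomorphic (grmod_cat A) (L k1) (regular_grmod A).
Proof.
move=> [p [pbij pnat]].
apply: (@corepresentable_iso (grmod_cat A) _ _
  (fun M => @hom (grvect_cat G k) k1 (forget A M))
  (fun M N u t => comp (fmap (forget A) u) t) (fun M => p k1 M)
  (fun M f => comp (fmap (forget A) f) ground_unit)).
- by move=> M; apply: pbij.
- exact: regular_universal.
- move=> M N u f.
  by rewrite -[X in p _ _ (comp _ X)]comph1 -fmap1 pnat comph1.
- by move=> M N u f; rewrite fmapM comphA.
Qed.

End Representing.

(** * Frobenius forms and the Casimir element *)

Section GradedFrobenius.
Variables (G : groupType) (k : fieldType) (A : gralg G k).

(** The form attached to an isomorphism of graded modules a |-> lam(- a) from A
    to A^*, stated without the module structures. *)
Definition frobenius_form (lam : 'Hom(A, k^o)) :=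
  [/\ (lam : dual A) \in @dual_comp _ _ A 1%g,
      forall a b : A, (forall x, lam (x * a) = lam (x * b)) -> a = b
    & forall g (f : dual A), f \in @dual_comp _ _ A g ->
        exists2 a : A, a \in gralg_comp g &
          forall x, lam (x * a) = (f : 'Hom(A, k^o)) x].

(** An A-linear map from A is determined by the image of 1, so an isomorphism
    A -> A^* is a |-> a lam = lam(- a). *)
Lemma frobenius_form_exists : graded_frobenius A ->
  exists lam, frobenius_form lam.
Proof.
move=> [th [th' [thK th'K]]].
have {}thK (x : A) : (th' (th x) : A) = x.
  exact: (congr1 (fun f : grmod_hom (regular_grmod A) (regular_grmod A) => f x)
    thK).
have {}th'K (f : dual A) : (th (th' f) : dual A) = f.
  exact: (congr1 (fun h : grmod_hom (dual_grmod A) (dual_grmod A) => h f)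
    th'K).
pose lam : dual A := th (1 : A).
have thE (a x : A) :
    ((th a : dual A) : 'Hom(A, k^o)) x = (lam : 'Hom(A, k^o)) (x * a).
  rewrite -dual_scaleE; congr ((_ : 'Hom(A, k^o)) x).
  by rewrite -linearZ; congr (th _); rewrite -[RHS]/(a * 1) mulr1.
exists lam; split=> [|a b ab|g f fg].
- by apply: (grmod_homP th); apply: one_homogeneous.
- rewrite -[a]thK -[b]thK; congr (th' _).
  by apply/lfunP => x; rewrite [LHS]thE [RHS]thE.
- exists (th' f : A) => [|x]; first exact: (grmod_homP th' fg).
  by rewrite -thE th'K.
Qed.

(** Dual families for the pairing lam(x y): the tensor sum_j e_j (x) e'_j is
    the Casimir element, of degree 1. Each expansion gives one triangle identity,
    and the two combine into centrality; the families need not be bases. *)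
Definition casimir (lam : 'Hom(A, k^o)) (J : Type) (r : seq J) (d : J -> G)
    (e e' : J -> A) :=
  [/\ forall j, e j \in gralg_comp (d j)^-1%g,
      forall j, e' j \in gralg_comp (d j),
      forall x, x = \sum_(j <- r) lam (x * e j) *: e' j
    & forall x, x = \sum_(j <- r) lam (e' j * x) *: e j].

(** The first expansion is the one of [homogeneous_coordinates], each coordinate
    form being written as lam(- e_j). Applying lam(y -) to the second one and
    expanding y by the first gives the same scalars. *)
Lemma casimir_exists lam : frobenius_form lam ->
  exists (J : Type) (r : seq J) d e e', @casimir lam J r d e e'.
Proof.
move=> [lam1 laminj lamsurj].
have [J [r [d [e' [c [e'A cA cE]]]]]] := homogeneous_coordinates A.
have /choice[e eP] : forall j, exists a : A, a \in gralg_comp (d j)^-1%g /\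
    forall x, lam (x * a) = (c j : 'Hom(A, k^o)) x.
  by move=> j; have [a aA aE] := lamsurj _ _ (cA j); exists a.
have xE x : x = \sum_(j <- r) lam (x * e j) *: e' j.
  by rewrite {1}[x]cE; apply: eq_bigr => j _; rewrite (eP j).2.
exists J, r, d, e, e'; split=> // [j|x]; first exact: (eP j).1.
apply: laminj => y.
rewrite {1}[y]xE mulr_suml linear_sum mulr_sumr linear_sum /=.
by apply: eq_bigr => j _; rewrite -scalerAl -scalerAr !linearZ /= [LHS]mulrC.
Qed.

Section CasimirAdjunction.
Variable lam : 'Hom(A, k^o).
Hypothesis lam1 : (lam : dual A) \in @dual_comp _ _ A 1%g.
Variables (J : Type) (r : seq J) (d : J -> G) (e e' : J -> A).
Hypothesis casP : casimir lam r d e e'.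

Section Unit.
Variable V : grvect G k.
Fact rank_one_unit_linear :
  linear (fun v : V => rank_one (lam : dual A) v : restr (coind A V)).
Proof.
move=> c v w; apply: coindP => x.
rewrite coindDE coind_restrZE /= /rank_one_fun scalerDr !scalerA.
by rewrite (mulrC c).
Qed.
Definition rank_one_unit_fun : {linear V -> restr (coind A V)} :=
  HB.pack (fun v : V => rank_one (lam : dual A) v : restr (coind A V))
    (GRing.isLinear.Build _ _ _ _ _ rank_one_unit_linear).
Fact rank_one_unit_homogeneous g (v : V) : v \in grvect_comp g ->
  rank_one_unit_fun v \in @coind_comp _ _ A V g.
Proof. by move=> vg; rewrite -[g]mul1g; apply: rank_one_homogeneous. Qed.
Definition rank_one_unit : grvect_hom V (forget_obj (coind_grmod A V)) :=
  @GrVectHom G k V (forget_obj (coind_grmod A V)) rank_one_unit_fun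
    rank_one_unit_homogeneous.
End Unit.

Section Counit.
Variable M : grmod A.
Definition casimir_sum (u : coind A (restr M)) : M :=
  \sum_(j <- r) e j *: (u (e' j) : M).

(** Centrality of the Casimir element: expand e'_j a in the e'_i, exchange the
    sums, and recognize the expansion of a e_i in the e_j. *)
Fact casimir_sum_linear : linear casimir_sum.
Proof.
have [_ _ xE' xE] := casP.
move=> a u v; rewrite /casimir_sum.
under eq_bigr do rewrite coindDE coindZE scalerDr.
rewrite big_split /=; congr (_ + _).
transitivity (\sum_(j <- r) \sum_(i <- r)
  (lam (e' j * (a * e i)) *: e j) *: (u (e' i) : M)).
  apply: eq_bigr => j _; rewrite {1}[e' j * a]xE' linear_sum scaler_sumr.
  apply: eq_bigr => i _; rewrite linearZ /= restr_scaleE scalerA mulr_algr.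
  by rewrite mulrA.
rewrite exchange_big scaler_sumr; apply: eq_bigr => i _ /=.
by rewrite -scaler_suml -xE scalerA.
Qed.
HB.instance Definition _ :=
  GRing.isLinear.Build A (coind A (restr M)) M *:%R casimir_sum
    casimir_sum_linear.

Fact casimir_sum_homogeneous g (u : coind A (restr M)) :
  u \in @coind_comp _ _ A (forget_obj M) g -> casimir_sum u \in grmod_comp g.
Proof.
have [eA e'A _ _] := casP.
move=> /asboolP ug; have [/(_ g) [M0 MP] _ _] := grmod_grading M.
apply: (big_ind (fun m => m \in grmod_comp g)) => // [m n mg ng|j _].
  by rewrite -[m](@scale1r k (restr M)); apply: MP.
by rewrite -[g](mulKg (d j)); apply: grmod_mul => //; apply: ug.
Qed.
Definition casimir_counit : grmod_hom (coind_grmod A (forget_obj M)) M :=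
  @GrModHom G k A (coind_grmod A (forget_obj M)) M casimir_sum
    casimir_sum_homogeneous.
End Counit.

(** The triangle identities are the two expansions: u(x) is the sum of the
    lam(x e_j) u(e'_j), and m = 1 m with 1 the sum of the lam(e'_j) e_j. *)
Lemma coinduction_forget_adjoint : left_adjoint (coinduction A) (forget A).
Proof.
have [_ _ xE' xE] := casP.
apply: (@unit_counit_adjoint (grvect_cat G k) (grmod_cat A) (coinduction A)
  (forget A) rank_one_unit casimir_counit).
- move=> V W u; apply: grvect_hom_inj => v; apply: coindP => x /=.
  by rewrite /rank_one_fun linearZ.
- move=> M N u; apply: grmod_hom_inj => f /=.
  by rewrite /casimir_sum linear_sum; apply: eq_bigr => j _; rewrite linearZ.
- move=> V; apply: grmod_hom_inj => f; apply: coindP => x /=.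
  rewrite /casimir_sum /= coind_sumE [in RHS](xE' x) linear_sum.
  by apply: eq_bigr => j _; rewrite coindZE linearZ.
- move=> M; apply: grvect_hom_inj => m /=.
  rewrite /forget_fun /= /casimir_sum /= -[RHS](@scale1r A M) (xE 1) scaler_suml.
  apply: eq_bigr => j _; rewrite /rank_one_fun mulr1.
  rewrite -[X in _ *: X]/((lam (e' j))%:A *: (m : M)) scalerA.
  by rewrite mulr_algr.
Qed.
End CasimirAdjunction.
End GradedFrobenius.

Theorem proposition7p3 (G : groupType) (k : fieldType) (A : gralg G k) :
  graded_frobenius A <-> frobenius_functor (forget A).
Proof.
split=> [/frobenius_form_exists [lam lamP]|[R [UR RU]]].
  have [J [r [d [e [e' cas]]]]] := casimir_exists lamP.
  have [lam1 _ _] := lamP.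
  exists (coinduction A); split; first exact: forget_coinduction_adjoint.
  exact: (coinduction_forget_adjoint lam1 cas).
apply: isomorphic_trans (isomorphic_sym (left_adjoint_ground RU)) _.
apply: isomorphic_trans (isomorphic_sym (dual_iso_coind A)).
exact: (right_adjoint_unique _ UR (forget_coinduction_adjoint A)).
Qed.
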